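(* For every integer $m\ge 2$, the sequence $\{u_i(m)\}_{2\le i\le m-2}$ is reverse ultra log-concave; that is, for all integers $i$ with $3\le i\le m-3$, $$(i-2)(m-i-2)\,u_i(m)^2\;\le\;(i-1)(m-i-1)\,u_{i-1}(m)\,u_{i+1}(m).$$
   Context: For integers $0\le i\le m$, the Boros–Moll numbers are $$d_i(m)=2^{-2m}\sum_{k=i}^m 2^k\binom{2m-2k}{m-k}\binom{m+k}{k}\binom{k}{i},$$ and for $1\le i\le m-1$, $$u_i(m)=\frac{d_{i-1}(m)\,d_{i+1}(m)}{d_i(m)^2}.$$ A finite sequence of real numbers $\{a_k\}_{0\le k\le n}$ is called reverse ultra log-concave if $k(n-k)a_k^2-(n-k+1)(k+1)a_{k-1}a_{k+1}\le 0$ for all $1\le k\le n-1$. For the sequence $\{u_i(m)\}_{2\le i\le m-2}$, which starts at index $2$, this definition is applied to $a_k=u_{k+2}(m)$, $0\le k\le n=m-4$. The statement is vacuous when there is no $i$ with $3\le i\le m-3$. *)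

(* Defs.v *)
From mathcomp Require Import all_boot all_order all_algebra.

Set Implicit Arguments.
Unset Strict Implicit.
Unset Printing Implicit Defensive.

Import Order.TTheory GRing.Theory Num.Theory.
Local Open Scope ring_scope.

(* All subtractions of naturals below are exact for [i <= m]. *)
Definition boros_moll (R : realFieldType) (i m : nat) : R :=
  2 ^- (2 * m) *
  \sum_(i <= k < m.+1)
    2 ^+ k * 'C(2 * m - 2 * k, m - k)%:R * 'C(m + k, k)%:R * 'C(k, i)%:R.

(* Meaningful for [1 <= i <= m - 1]. *)
Definition boros_moll_ratio (R : realFieldType) (i m : nat) : R :=
  boros_moll R i.-1 m * boros_moll R i.+1 m / boros_moll R i m ^+ 2.

(* The finite sequence is [a 0, ..., a n]; other values of [a] are irrelevant. *)
Definition reverse_ultra_log_concave (R : realFieldType) (n : nat)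
    (a : nat -> R) : Prop :=
  forall k : nat, (1 <= k <= n - 1)%N ->
    k%:R * (n%:R - k%:R) * a k ^+ 2
      - (n%:R - k%:R + 1) * (k%:R + 1) * a k.-1 * a k.+1 <= 0.

(* Main.v *)
Require Import Defs.
From mathcomp Require Import all_boot all_order all_algebra.
From mathcomp Require Import ring lra zify.

Set Implicit Arguments.
Unset Strict Implicit.
Unset Printing Implicit Defensive.

Import Order.TTheory GRing.Theory Num.Theory.
Local Open Scope ring_scope.

(** For fixed [m], write [d_i] for the Boros-Moll numbers and put
    [s_i = i d_i / d_(i-1)].  Then [u_i = (s_(i+1) / s_i) * (i / (i+1))], and
    with [j = m - i] the claim becomes
<<
      (i-2)(j-2) i^3 (i+2) s_(i+1)^2 (s_(i-1) s_(i+1))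
        <= (i-1)^2 (j-1) (i+1)^3 s_i^2 (s_i s_(i+2)).
>>
    The numerical factor on the right exceeds the one on the left by a
    proportion of about [1/i + 1/j], whereas [s] is nearly log-linear: its
    log-concavity quotients [s_(k-1) s_(k+1) / s_k^2] differ from 1 by terms of
    lower order, away from the ends of the range.  So crude bounds on these
    quotients are enough:
<<
      (m+1) s_(i-1) s_(i+1) <= (m+2) s_i^2,
      (2i-1)(2j-1) s_(i+1)^2 <= 4ij s_i s_(i+2),
>>
    and [index_factor_ineq] checks that the numerical gap absorbs both losses.

    The quotients are controlled through the three-term recurrence in [i], which
    follows from Zeilberger's method ([boros_moll_recurrence]) and for [s] reads
    [s_k (2m+1 - s_(k+1)) = (m+1-k)(m+k)], with [s_(m+1) = 0].  As a backward
    recursion it is monotone, so a downward induction gives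
<<
      (2k-2)/(2k-1) <= s_k / (m+1-k) <= (2m+2)/(2m+3).
>>
    The recurrence also expresses [s_(k-1)] and [s_(k+1)] by [s_k], which turns
    each bound on a quotient into an inequality between polynomials in the
    relative defect [z = 1 - s_k / (m+1-k)].  The only nonlinear term in it is a
    quartic in [z], which is convex where it matters; replacing it by its tangent
    at 0, or by a linear function slightly above its chord, leaves an inequality
    linear in [z].  It is then enough to look at the two ends of the interval
    where [z] lives, and there the inequality is one between polynomials in [k]
    and [m+1-k] whose difference has nonnegative coefficients after a shift of
    the variables.

    Below, [h] stands for [m+1-k], so that [2h+2k-1 = 2m+1] and
    [h+2k-1 = m+k]. *)

(** * The three-term recurrence *)

Lemma central_bin_rec n :
  (n.+1 * 'C(2 * n.+1, n.+1) = 2 * (2 * n + 1) * 'C(2 * n, n))%N.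
Proof.
have E1 := mul_bin_diag (2 * n.+1) n; have E2 := mul_bin_down (2 * n).+1 n.
rewrite (_ : (2 * n.+1).-1 = (2 * n).+1) in E1; last by lia.
rewrite /= (_ : ((2 * n).+1 - n = n.+1)%N) in E2; last by lia.
nia.
Qed.

(** The part of the summand that does not depend on [i]. *)
Definition boros_moll_weight (R : realFieldType) (m k : nat) : R :=
  2 ^+ k * 'C(2 * m - 2 * k, m - k)%:R * 'C(m + k, k)%:R.

Lemma boros_moll_weight_rec (R : realFieldType) m k : (k < m)%N ->
  (2 * (m%:R - k%:R) - 1) * (k%:R + 1) * boros_moll_weight R m k.+1
    = (m%:R - k%:R) * (m%:R + k%:R + 1) * boros_moll_weight R m k.
Proof.
move=> /subnKC; move: (m - k.+1)%N => n <- {m}; rewrite /boros_moll_weight.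
rewrite (_ : (2 * (k.+1 + n) - 2 * k = 2 * n.+1)%N); last by lia.
rewrite (_ : (k.+1 + n - k = n.+1)%N); last by lia.
rewrite (_ : (2 * (k.+1 + n) - 2 * k.+1 = 2 * n)%N); last by lia.
rewrite (_ : (k.+1 + n - k.+1 = n)%N); last by lia.
have E1 := central_bin_rec n.
have E2 : ((k.+1 + n + k.+1) * 'C(k.+1 + n + k, k)
     = k.+1 * 'C(k.+1 + n + k.+1, k.+1))%N.
  by rewrite -mul_bin_diag addnS.
move: ('C(2 * n.+1, _)) ('C(2 * n, _)) E1 => c1 c0.
move: ('C(k.+1 + n + k.+1, _)) ('C(k.+1 + n + k, _)) E2 => b1 b0.
move=> /(congr1 (GRing.natmul (1 : R))) E2 /(congr1 (GRing.natmul (1 : R))) E1.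
rewrite exprS; move: (2 ^+ k) => p2.
rewrite !natrM !natrD -!natr1 in E1 E2 *.
transitivity ((n%:R + 1) * c1%:R * ((k%:R + 1) * b1%:R) * p2).
  by rewrite E1; ring.
by rewrite -E2; ring.
Qed.

(** Summing from 0 makes the range independent of [i], as is needed to add the
    sums for three consecutive values of [i] term by term. *)
Lemma boros_moll_full_sum (R : realFieldType) i m : boros_moll R i m =
  2 ^- (2 * m) * \sum_(0 <= k < m.+1) boros_moll_weight R m k * 'C(k, i)%:R.
Proof.
rewrite /boros_moll; congr (_ * _).
have [im|mi] := leqP i m.+1.
  rewrite [RHS](big_cat_nat _ (n := i)) //= [X in _ = X + _]big1_seq ?add0r //.
  by move=> k /=; rewrite mem_index_iota => /bin_small ->; rewrite mulr0.
rewrite big_geq; last exact: ltnW.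
rewrite big1_seq // => k /=; rewrite mem_index_iota => /= km.
by rewrite bin_small ?mulr0 // (leq_trans km) // ltnW.
Qed.

Lemma boros_moll_gt0 (R : realFieldType) i m : (i <= m)%N -> 0 < boros_moll R i m.
Proof.
move=> im; rewrite /boros_moll mulr_gt0 ?invr_gt0 ?exprn_gt0 ?ltr0n //.
rewrite big_nat_recr //=; apply: ltr_wpDl.
  by rewrite big_seq; apply: sumr_ge0 => k _; rewrite !mulr_ge0 ?exprn_ge0 ?ler0n.
by rewrite !mulr_gt0 ?exprn_gt0 ?ltr0n ?bin_gt0 ?leq_addl //; lia.
Qed.

(** Creative telescoping.  With [t k] the summand for [i], the combination of
    the summands for [i], [i+1], [i+2] is [p k * t k], where [p] is a quadratic
    polynomial, and [p k * t k = G (k+1) - G k] for the certificate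
    [G k = (2(m-k)+1) (k-i) t k].  Here [G 0 = 0], and the last term
    [p m * t m] is [- G m]. *)
Lemma boros_moll_recurrence (R : realFieldType) i m :
  (i%:R + 1) * (i%:R + 2) * boros_moll R i.+2 m
    - (i%:R + 1) * (2 * m%:R + 1) * boros_moll R i.+1 m
    + (m%:R - i%:R) * (m%:R + i%:R + 1) * boros_moll R i m = 0.
Proof.
have binS k j : (j%:R + 1) * 'C(k, j.+1)%:R = (k%:R - j%:R) * 'C(k, j)%:R :> R.
  have [jk|kj] := leqP j k; last first.
    by rewrite !bin_small ?mulr0 // ltnW.
  by rewrite natr1 -natrM mul_bin_left natrM natrB.
pose t k := boros_moll_weight R m k * 'C(k, i)%:R.
pose p k : R := (m%:R - k%:R) * (m%:R + k%:R + 1)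
                - (2 * (m%:R - k%:R) + 1) * (k%:R - i%:R).
have partial n : (n <= m)%N -> \sum_(0 <= k < n) p k * t k
    = (2 * (m%:R - n%:R) + 1) * (n%:R - i%:R) * t n.
  elim: n => [_|n IH nm].
    rewrite big_geq // /t bin0n; case: eqP => [->|_]; last by rewrite !mulr0.
    by rewrite subrr mulr0 mul0r.
  rewrite big_nat_recr //= IH 1?ltnW //.
  have E := boros_moll_weight_rec R nm.
  have B : (n%:R + 1 - i%:R) * 'C(n.+1, i)%:R = (n%:R + 1) * 'C(n, i)%:R :> R.
    have [ni|ni] := leqP i n.+1; last by rewrite !bin_small ?mulr0 // ltnW.
    by rewrite natr1 -natrB // -!natrM mul_bin_down.
  rewrite -natr1 /t /p.
  transitivity ((m%:R - n%:R) * (m%:R + n%:R + 1) * boros_moll_weight R m n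
                 * 'C(n, i)%:R); first by ring.
  rewrite -E.
  transitivity ((2 * (m%:R - n%:R) - 1) * boros_moll_weight R m n.+1
                 * ((n%:R + 1) * 'C(n, i)%:R)); first by ring.
  by rewrite -B; ring.
have total : \sum_(0 <= k < m.+1) p k * t k = 0.
  by rewrite big_nat_recr //= partial // /p; ring.
transitivity (2 ^- (2 * m) * \sum_(0 <= k < m.+1) p k * t k); last first.
  by rewrite total mulr0.
rewrite !boros_moll_full_sum !mulrA ![_ * 2 ^- _]mulrC -!mulrA -mulrBr -mulrDr.
congr (_ * _).
rewrite !mulrA !mulr_sumr -sumrB -big_split /=.
apply: eq_bigr => k _; rewrite /t /p.
have B1 := binS k i; have B2 := binS k i.+1; rewrite -natr1 in B2.
transitivity (boros_moll_weight R m k * (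
   (i%:R + 1) * ((i%:R + 1 + 1) * 'C(k, i.+2)%:R)
   - (2 * m%:R + 1) * ((i%:R + 1) * 'C(k, i.+1)%:R)
   + (m%:R - i%:R) * (m%:R + i%:R + 1) * 'C(k, i)%:R)); first by ring.
rewrite B2.
transitivity (boros_moll_weight R m k * (
   (k%:R - (i%:R + 1)) * ((i%:R + 1) * 'C(k, i.+1)%:R)
   - (2 * m%:R + 1) * ((i%:R + 1) * 'C(k, i.+1)%:R)
   + (m%:R - i%:R) * (m%:R + i%:R + 1) * 'C(k, i)%:R)); first by ring.
by rewrite B1; ring.
Qed.

(** * Bounds propagated by the backward recursion *)

(** Sums are left alone by [pos] and split by [posD]: the former serves for
    products of linear factors such as [h - 1], whose sign [lra] decides. *)
Ltac pos :=
  repeat match goal with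
  | |- is_true (0 <= _ * _) => apply: mulr_ge0
  | |- is_true (0 <= _ ^+ _) => apply: exprn_ge0
  end.
Ltac posD :=
  repeat match goal with
  | |- is_true (0 <= _ + _) => apply: addr_ge0
  | |- is_true (0 <= _ * _) => apply: mulr_ge0
  | |- is_true (0 <= _ ^+ _) => apply: exprn_ge0
  end; rewrite ?ler0n //.

(** One step of the backward recursion, from [t = s_(k+1)] to [s = s_k].  Since
    [s] increases with [t], it suffices that the bound for [t] is mapped below
    the bound for [s]; [D] is [2m+1 - t] at the former, times [2m+3]. *)
Lemma slope_upper_step (R : realFieldType) (h i s t : R) :
  1 <= i -> 1 <= h -> 0 < s ->
  s * (2 * h + 2 * i - 1 - t) = h * (h + 2 * i - 1) ->
  (2 * h + 2 * i + 1) * t <= (h - 1) * (2 * h + 2 * i) ->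
  (2 * h + 2 * i + 1) * s <= h * (2 * h + 2 * i).
Proof.
move=> i1 h1 s0 E tb.
have [x x0 Ex] : exists2 x, 0 <= x & i = 1 + x by exists (i - 1); lra.
have [y y0 Ey] : exists2 y, 0 <= y & h = 1 + y by exists (h - 1); lra.
pose n := h + 2 * i - 1; pose N := 2 * h + 2 * i - 1.
pose D := (N + 2) * N - (h - 1) * (N + 1).
have hD : 0 <= (N + 1) * D - (N + 2) ^+ 2 * n.
  have -> : (N + 1) * D - (N + 2) ^+ 2 * n
    = 10 + 13 * y + 4 * y ^+ 2 + 4 * x + 4 * x * y.
    by rewrite /D /N /n Ex Ey; ring.
  by posD.
have D0 : 0 < D.
  have -> : D = 15 + (12 * y + 16 * x + 6 * x * y + 4 * x ^+ 2 + 2 * y ^+ 2).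
    by rewrite /D /N Ex Ey; ring.
  by apply: ltr_wpDr; [posD | rewrite ltr0n].
have sD : s * D <= (N + 2) * (h * n).
  rewrite -[h * n]E -subr_ge0.
  set X := _ - _.
  have -> : X = s * ((h - 1) * (2 * h + 2 * i) - (2 * h + 2 * i + 1) * t).
    by rewrite /X /D /N; ring.
  by rewrite mulr_ge0 ?subr_ge0 // ltW.
rewrite -(ler_pM2r D0) -mulrA.
have -> : 2 * h + 2 * i + 1 = N + 2 by rewrite /N; ring.
have -> : 2 * h + 2 * i = N + 1 by rewrite /N; ring.
apply: (@le_trans _ _ (h * ((N + 2) ^+ 2 * n))).
  have -> : h * ((N + 2) ^+ 2 * n) = (N + 2) * ((N + 2) * (h * n)) by ring.
  by rewrite ler_wpM2l // /N; lra.
rewrite -[X in _ <= X]mulrA.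
by apply: ler_wpM2l; [lra | rewrite -subr_ge0].
Qed.

(** The same step for the lower bound, where [D] is [2m+1 - t] at the bound for
    [t], times [2i+1]. *)
Lemma slope_lower_step (R : realFieldType) (h i s t : R) :
  1 <= i -> 1 <= h -> 0 < s ->
  s * (2 * h + 2 * i - 1 - t) = h * (h + 2 * i - 1) ->
  (h - 1) * (2 * i) <= (2 * i + 1) * t ->
  h * (2 * i - 2) <= (2 * i - 1) * s.
Proof.
move=> i1 h1 s0 E tb.
have [x x0 Ex] : exists2 x, 0 <= x & i = 1 + x by exists (i - 1); lra.
have [y y0 Ey] : exists2 y, 0 <= y & h = 1 + y by exists (h - 1); lra.
pose n := h + 2 * i - 1; pose N := 2 * h + 2 * i - 1.
pose D := N * (2 * i + 1) - (h - 1) * (2 * i).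
have hD : 0 <= n * (2 * i - 1) * (2 * i + 1) - (2 * i - 2) * D.
  have -> : n * (2 * i - 1) * (2 * i + 1) - (2 * i - 2) * D = 6 + 3 * y + 4 * x.
    by rewrite /D /N /n Ex Ey; ring.
  by lra.
have D0 : 0 < D.
  have -> : D = 9 + (12 * x + 4 * x ^+ 2 + 4 * y + 2 * x * y).
    by rewrite /D /N Ex Ey; ring.
  by apply: ltr_wpDr; [posD | rewrite ltr0n].
have sD : (2 * i + 1) * (h * n) <= s * D.
  rewrite -[h * n]E -subr_ge0.
  set X := _ - _; have -> : X = s * ((2 * i + 1) * t - (h - 1) * (2 * i)).
    by rewrite /X /D /N; ring.
  by rewrite mulr_ge0 ?subr_ge0 // ltW.
rewrite -(ler_pM2r D0) -mulrA -[X in _ <= X]mulrA.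
apply: (@le_trans _ _ ((2 * i - 1) * ((2 * i + 1) * (h * n)))); last first.
  by rewrite ler_wpM2l //; lra.
have -> : (2 * i - 1) * ((2 * i + 1) * (h * n))
  = h * (n * (2 * i - 1) * (2 * i + 1)) by ring.
by apply: ler_wpM2l; [lra | rewrite -subr_ge0].
Qed.

(** * Log-concavity quotients as functions of one slope *)

(** Write [n = h+2i-1] and [N = n+h].  Beyond [z = h/N] the left-hand side is
    negative.  Below, [(1-z)^3 (n+hz)] lies above its tangent at [z = 0]
    ([key]).  What remains is linear in [z], and it is a combination with
    nonnegative coefficients of [u] and [v], which are nonnegative and vanish at
    the ends [z = h/N] and [z = 1/(N+2)]. *)
Lemma slope_quotient_upper_poly (R : realFieldType) (h i z : R) :
  1 <= i -> 1 <= h -> z < 1 -> 1 <= (2 * h + 2 * i + 1) * z ->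
  (h + i) * ((h + 1) * (h + 2 * i - 2)) * (h - (2 * h + 2 * i - 1) * z)
   <= (h + i + 1) * h ^+ 2 * (1 - z) ^+ 3 * (h + 2 * i - 1 + h * z).
Proof.
move=> i1 h1 z1 ze.
have z0 : 0 < z.
  have c0 : 0 < 2 * h + 2 * i + 1 by lra.
  by rewrite -(pmulr_rgt0 _ c0) (lt_le_trans ltr01).
pose n := h + 2 * i - 1; pose N := 2 * h + 2 * i - 1.
have hz0 : 0 <= h * z by rewrite mulr_ge0 // ?ltW //; lra.
have rhs0 : 0 <= (1 - z) ^+ 3 * (n + h * z) by rewrite /n; pos; lra.
have [x x0 Ex] : exists2 x, 0 <= x & i = 1 + x by exists (i - 1); lra.
have [y y0 Ey] : exists2 y, 0 <= y & h = 1 + y by exists (h - 1); lra.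
have [u0|u0] := leP (h - N * z) 0.
  apply: (@le_trans _ _ 0).
    by apply: mulr_ge0_le0 => //; pos; lra.
  by rewrite -!mulrA; pos; lra.
pose u := h - N * z; pose v := (N + 2) * z - 1.
pose K := h * (N + 2) - N.
pose b := (h + i + 1) * h * n - (h + i) * (h + 1) * (n - 1).
have key : n * u + z * (n - h) ^+ 2 <= h * (1 - z) ^+ 3 * (n + h * z).
  rewrite -subr_ge0.
  have -> : h * (1 - z) ^+ 3 * (n + h * z) - (n * u + z * (n - h) ^+ 2)
    = z ^+ 2 * h * ((n - h) * (3 - z) + h * z * (2 - z)).
    by rewrite /u /N /n; ring.
  by apply: mulr_ge0; last apply: addr_ge0; rewrite /n; pos; lra.
(* This is the coefficient of [u] in that combination, which is found by means
   of [K * z = u + h * v]. *)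
have A : 0 <= (h + i + 1) * h * (n - h) ^+ 2 + K * b.
  have -> : (h + i + 1) * h * (n - h) ^+ 2 + K * b =
    7 + 20 * y + 22 * y ^+ 2 + 11 * y ^+ 3 + 2 * y ^+ 4 + 9 * x
      + 11 * x * y + 6 * x * y ^+ 2 + 2 * x * y ^+ 3
      + 12 * x ^+ 2 + 6 * x ^+ 2 * y + 4 * x ^+ 3.
    by rewrite /K /b /N /n Ex Ey; ring.
  by posD.
have K0 : 0 < K.
  by have : 0 <= (h - 1) * N; [rewrite /N; pos; lra | rewrite /K; lra].
have lin : (h + i) * ((h + 1) * (n - 1)) * u
   <= (h + i + 1) * h * (n * u + z * (n - h) ^+ 2).
  rewrite -subr_ge0 -(pmulr_rge0 _ K0).
  set X := K * _.
  have -> : X = ((h + i + 1) * h * (n - h) ^+ 2 + K * b) * u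
    + (h + i + 1) * h * (n - h) ^+ 2 * h * v.
    by rewrite /X /u /v /K /b; ring.
  apply: addr_ge0; first by rewrite mulr_ge0 // ltW.
  by pos; rewrite /v /N /n; lra.
have -> : h + 2 * i - 2 = n - 1 by rewrite /n; ring.
apply: (le_trans lin).
have -> : (h + i + 1) * h ^+ 2 * (1 - z) ^+ 3 * (n + h * z)
   = (h + i + 1) * h * (h * (1 - z) ^+ 3 * (n + h * z)) by ring.
by rewrite ler_wpM2l //; pos; lra.
Qed.

(** Here [w = 2k-1], and [w * z] runs over the unit interval.  The quartic on the
    left is replaced by its part linear in [z] plus the largest values that
    [3 w z^2 - w z^3] and [2 h z^3], divided by [z], can take ([quartic]).  The
    difference of the two sides is then linear in [z], and is nonnegative
    because it is so at [z = 0] and at [z = 1/w]. *)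
Lemma slope_quotient_lower_poly (R : realFieldType) (h w z : R) :
  3 <= h -> 7 <= w -> 0 <= z -> w * z <= 1 ->
  (w - 2) * (2 * h - 1) * h * (1 - z) ^+ 3 * (h + w + h * z)
    <= 2 * (w - 1) * ((h + 1) * (h + w - 1)) * (h - (2 * h + w) * z).
Proof.
move=> h3 w7 z0 wz1.
have h0 : 0 <= h by lra.
have w0 : 0 < w by lra.
have w0' := ltW w0.
have wz0 : 0 <= w * z by rewrite mulr_ge0.
pose n := h + w; pose N := n + h.
pose c := (h - 3 * n) * w ^+ 2 + 3 * w ^+ 2 - w + 2 * h.
have quartic : w ^+ 2 * ((1 - z) ^+ 3 * (n + h * z)) <= n * w ^+ 2 + c * z.
  rewrite -subr_ge0.
  have -> : n * w ^+ 2 + c * z - w ^+ 2 * ((1 - z) ^+ 3 * (n + h * z))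
    = z * (w * (1 - w * z) * (3 * w - 1 - w * z)
           + 2 * h * (1 - w * z) * (1 + w * z) + h * z * (w * z) * (w * z)).
    by rewrite /c /n; ring.
  apply: mulr_ge0 => //; apply: addr_ge0; first apply: addr_ge0;
    by pos => //; lra.
pose p := 2 * (w - 1) * ((h + 1) * (n - 1)); pose q := (w - 2) * (2 * h - 1) * h.
have q0 : 0 <= q by rewrite /q; pos; lra.
have left_end : 0 <= p * h - q * n.
  have -> : p * h - q * n
    = h * (3 * w * (w - 2) + 2 * h * (h - 1) + 3 * w * h + 2).
    by rewrite /p /q /n; ring.
  apply: mulr_ge0 => //; apply: addr_ge0 => //.
  by do 2?[apply: addr_ge0]; pos => //; lra.
(* Expanded in powers of [h - 3]; the coefficients are nonnegative for
   [7 <= w]. *)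
have right_end : 0 <= w ^+ 2 * p * (h * w - N) - q * (n * w ^+ 3 + c).
  have -> : w ^+ 2 * p * (h * w - N) - q * (n * w ^+ 3 + c) =
    (w - 7) * (w ^+ 3 * (w + 5) + 21 * w) + (27 * w + 180)
    + (h - 3) * ((w - 7) * (w ^+ 4 + 14 * w ^+ 3 + 11 * w ^+ 2 + 66 * w)
                 + (64 * w ^+ 3 + 344 * w + 192))
    + (h - 3) ^+ 2 * ((w - 7) * (3 * w ^+ 3 + 18 * w ^+ 2 + 38 * w)
                 + (5 * w ^+ 3 + 70 * w ^+ 2 + 228 * w + 68))
    + (h - 3) ^+ 3 * (2 * (w - 2) * (w ^+ 2 - 2)).
    by rewrite /p /q /c /N /n; ring.
  have x0 : 0 <= w - 7 by lra.
  have y0 : 0 <= h - 3 by lra.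
  have w20 : 0 <= w ^+ 2 - 2 by rewrite expr2; nra.
  have w2 : 0 <= w - 2 by lra.
  move: (w - 7) (h - 3) (w - 2) (w ^+ 2 - 2) x0 y0 w2 w20 => x y w2 w20 *.
  by posD.
rewrite -/n; have -> : 2 * h + w = N by rewrite /N /n; ring.
rewrite -/p -(ler_pM2l (exprn_gt0 2 w0)).
have -> : w ^+ 2 * (q * (1 - z) ^+ 3 * (n + h * z))
  = q * (w ^+ 2 * ((1 - z) ^+ 3 * (n + h * z))) by ring.
apply: (le_trans (ler_wpM2l q0 quartic)).
rewrite -subr_ge0.
have -> : w ^+ 2 * (p * (h - N * z)) - q * (n * w ^+ 2 + c * z)
  = (1 - w * z) * (w ^+ 2 * (p * h - q * n))
    + z * (w ^+ 2 * p * (h * w - N) - q * (n * w ^+ 3 + c)) by ring.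
by apply: addr_ge0; apply: mulr_ge0 => //; [lra | pos].
Qed.

(** The recurrence at [k-1] and at [k] solves for [r = s_(k-1)] and
    [t = s_(k+1)] in terms of the defect [z] of [s = s_k]. *)
Lemma slope_quotient_defect (R : realFieldType) (h i r s t z : R) :
  0 < h -> s = h * (1 - z) ->
  r * (2 * h + 2 * i - 1 - s) = (h + 1) * (h + 2 * i - 2) ->
  s * (2 * h + 2 * i - 1 - t) = h * (h + 2 * i - 1) ->
  r * t * ((1 - z) * (h + 2 * i - 1 + h * z))
    = (h + 1) * (h + 2 * i - 2) * (h - (2 * h + 2 * i - 1) * z).
Proof.
move=> h0 -> Er Es.
have Et : (1 - z) * t = h - (2 * h + 2 * i - 1) * z.
  by apply: (mulfI (lt0r_neq0 h0)); lra.
by rewrite -Er -Et; ring.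
Qed.

Lemma slope_quotient_upper (R : realFieldType) (h i r s t : R) :
  1 <= i -> 1 <= h -> 0 < s ->
  r * (2 * h + 2 * i - 1 - s) = (h + 1) * (h + 2 * i - 2) ->
  s * (2 * h + 2 * i - 1 - t) = h * (h + 2 * i - 1) ->
  (2 * h + 2 * i + 1) * s <= h * (2 * h + 2 * i) ->
  (h + i) * (r * t) <= (h + i + 1) * s ^+ 2.
Proof.
move=> i1 h1 s0 Er Es ub.
have h0 : 0 < h by lra.
have [z Ez] : exists z, s = h * (1 - z).
  by exists (1 - s / h); field; rewrite gt_eqF.
have z1 : z < 1 by rewrite -subr_gt0 -(pmulr_rgt0 _ h0) -Ez.
have zb : 1 <= (2 * h + 2 * i + 1) * z.
  by rewrite -(ler_pM2l h0); rewrite Ez in ub; lra.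
have z0 : 0 < z.
  have c0 : 0 < 2 * h + 2 * i + 1 by lra.
  by rewrite -(pmulr_rgt0 _ c0) (lt_le_trans ltr01).
have hz : 0 < h * z by rewrite mulr_gt0.
have c0 : 0 < (1 - z) * (h + 2 * i - 1 + h * z) by apply: mulr_gt0; lra.
have E := slope_quotient_defect h0 Ez Er Es.
have step := slope_quotient_upper_poly i1 h1 z1 zb.
rewrite -(ler_pM2r c0) -[X in X <= _]mulrA E Ez.
lra.
Qed.

Lemma slope_quotient_lower (R : realFieldType) (h k r s t : R) :
  4 <= k -> 3 <= h -> 0 < s ->
  r * (2 * h + 2 * k - 1 - s) = (h + 1) * (h + 2 * k - 2) ->
  s * (2 * h + 2 * k - 1 - t) = h * (h + 2 * k - 1) ->
  s <= h -> h * (2 * k - 2) <= (2 * k - 1) * s ->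
  (2 * k - 3) * (2 * h - 1) * s ^+ 2 <= 4 * (k - 1) * h * (r * t).
Proof.
move=> k4 h3 s0 Er Es sh lb.
have h0 : 0 < h by lra.
have [z Ez] : exists z, s = h * (1 - z).
  by exists (1 - s / h); field; rewrite gt_eqF.
have z1 : z < 1 by rewrite -subr_gt0 -(pmulr_rgt0 _ h0) -Ez.
have z0 : 0 <= z by rewrite -(pmulr_rge0 _ h0); rewrite Ez in sh; lra.
have hz : 0 <= h * z by rewrite pmulr_rge0.
have w7 : 7 <= 2 * k - 1 by lra.
have zb : (2 * k - 1) * z <= 1.
  by rewrite -(ler_pM2l h0); rewrite Ez in lb; lra.
have c0 : 0 < (1 - z) * (h + 2 * k - 1 + h * z) by apply: mulr_gt0; lra.
have E := slope_quotient_defect h0 Ez Er Es.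
have step := ler_wpM2l (ltW h0) (slope_quotient_lower_poly h3 w7 z0 zb).
rewrite -(ler_pM2r c0) -[X in _ <= X]mulrA E Ez.
lra.
Qed.

(** * Slopes of the Boros-Moll numbers and their ratios *)

(** This is [s_(k+1)] in the notation of the introduction: the index is shifted
    so that no predecessor occurs. *)
Definition boros_moll_slope (R : realFieldType) (m k : nat) : R :=
  (k%:R + 1) * boros_moll R k.+1 m / boros_moll R k m.

Lemma boros_moll_slope_gt0 (R : realFieldType) m k :
  (k < m)%N -> 0 < boros_moll_slope R m k.
Proof.
move=> km; rewrite /boros_moll_slope natr1.
have d0 := boros_moll_gt0 R (ltnW km); have d1 := boros_moll_gt0 R km.
by apply: divr_gt0 => //; apply: mulr_gt0 => //; rewrite ltr0n.
Qed.

Lemma boros_moll_slope_end (R : realFieldType) m : boros_moll_slope R m m = 0.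
Proof.
rewrite /boros_moll_slope [boros_moll R m.+1 m]/boros_moll big_geq //.
by rewrite !(mulr0, mul0r).
Qed.

Lemma boros_moll_slope_rec (R : realFieldType) m k : (k < m)%N ->
  boros_moll_slope R m k * (2 * m%:R + 1 - boros_moll_slope R m k.+1)
    = (m%:R - k%:R) * (m%:R + k%:R + 1).
Proof.
move=> km; have := boros_moll_recurrence R k m.
have d0 := lt0r_neq0 (boros_moll_gt0 R (ltnW km)).
have d1 := lt0r_neq0 (boros_moll_gt0 R km).
rewrite /boros_moll_slope -natr1 => E.
apply: (mulIf d0); apply/eqP; rewrite -subr_eq0 -oppr_eq0 -[X in _ == X]E; apply/eqP.
by field; rewrite d0 d1.
Qed.

(** Downward induction from [k = m], where both sides vanish. *)
Lemma boros_moll_slope_ub (R : realFieldType) m k : (k <= m)%N ->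
  (2 * m%:R + 3) * boros_moll_slope R m k <= (m%:R - k%:R) * (2 * m%:R + 2).
Proof.
move=> /subnK; move: (m - k)%N => h; elim: h k => [|h IH] k Em.
  by rewrite -Em add0n boros_moll_slope_end subrr mulr0 mul0r.
have km : (k < m)%N by lia.
have ub := IH k.+1 (etrans (addnS h k) Em).
have E := boros_moll_slope_rec R km.
have [i1 h1] : (1 <= k%:R + 1 :> R) /\ (1 <= m%:R - k%:R :> R).
  by rewrite -natrB ?(ltnW km) // natr1 !ler1n subn_gt0.
have := @slope_upper_step R (m%:R - k%:R) (k%:R + 1) _ (boros_moll_slope R m k.+1)
  i1 h1 (boros_moll_slope_gt0 R km).
rewrite -natr1 in ub.
rewrite (_ : 2 * (m%:R - k%:R) + 2 * (k%:R + 1) = 2 * m%:R + 2); last by ring.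
by move=> H; have := H _ _; lra.
Qed.

Lemma boros_moll_slope_lb (R : realFieldType) m k : (k <= m)%N ->
  (m%:R - k%:R) * (2 * k%:R) <= (2 * k%:R + 1) * boros_moll_slope R m k.
Proof.
move=> /subnK; move: (m - k)%N => h; elim: h k => [|h IH] k Em.
  by rewrite -Em add0n boros_moll_slope_end subrr mulr0 mul0r.
have km : (k < m)%N by lia.
have ub := IH k.+1 (etrans (addnS h k) Em).
have E := boros_moll_slope_rec R km.
have [i1 h1] : (1 <= k%:R + 1 :> R) /\ (1 <= m%:R - k%:R :> R).
  by rewrite -natrB ?(ltnW km) // natr1 !ler1n subn_gt0.
have := @slope_lower_step R (m%:R - k%:R) (k%:R + 1) _ (boros_moll_slope R m k.+1)
  i1 h1 (boros_moll_slope_gt0 R km).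
rewrite -natr1 in ub.
by move=> H; have := H _ _; lra.
Qed.

(** Separate the variables: [(1 + 1/(2x)) (1 + 1/(2y))]
    dominates [1 + 1/(x+y+1)], and the first factor is absorbed by the part in
    [x], the second by the part in [y]. *)
Lemma index_factor_ineq (R : realFieldType) (x y : R) : 2 <= x -> 2 <= y ->
  (x - 2) * (y - 2) * x ^+ 3 * (x + 2) * ((x + y + 2) * (4 * x * y))
  <= (x - 1) ^+ 2 * (y - 1) * (x + 1) ^+ 3
     * ((x + y + 1) * ((2 * x - 1) * (2 * y - 1))).
Proof.
move=> x2 y2.
have cross : (x + y + 2) * (4 * x * y) <= (x + y + 1) * ((2 * x + 1) * (2 * y + 1)).
  rewrite -subr_ge0; set X := _ - _.
  have -> : X = (2 * x + 2 * y + 1) * (x + y + 1) - 4 * x * y by rewrite /X; ring.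
  have -> : (2 * x + 2 * y + 1) * (x + y + 1) - 4 * x * y
    = 2 * x ^+ 2 + 2 * y ^+ 2 + 3 * x + 3 * y + 1 by ring.
  have := sqr_ge0 x; have := sqr_ge0 y; lra.
have xpart : x ^+ 3 * (2 * x + 1) * (x - 2) * (x + 2)
    <= (x - 1) ^+ 2 * (x + 1) ^+ 3 * (2 * x - 1).
  rewrite -subr_ge0; set X := _ - _.
  have -> : X = 3 * x ^+ 4 + 2 * x ^+ 3 + 4 * x ^+ 2 + (x - 1) by rewrite /X; ring.
  have x1 : 0 <= x - 1 by lra.
  have x0 : 0 <= x by lra.
  by move: (x - 1) x1 => x' x1; posD.
have ypart : (2 * y + 1) * (y - 2) <= (y - 1) * (2 * y - 1) by lra.
have c0 : 0 <= (x - 2) * (y - 2) * x ^+ 3 * (x + 2) by pos; lra.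
apply: (le_trans (ler_wpM2l c0 cross)).
have s0 : 0 <= x + y + 1 by lra.
have -> : (x - 2) * (y - 2) * x ^+ 3 * (x + 2)
    * ((x + y + 1) * ((2 * x + 1) * (2 * y + 1)))
  = (x + y + 1) * ((x ^+ 3 * (2 * x + 1) * (x - 2) * (x + 2))
                   * ((2 * y + 1) * (y - 2))) by ring.
have -> : (x - 1) ^+ 2 * (y - 1) * (x + 1) ^+ 3
    * ((x + y + 1) * ((2 * x - 1) * (2 * y - 1)))
  = (x + y + 1) * (((x - 1) ^+ 2 * (x + 1) ^+ 3 * (2 * x - 1))
                   * ((y - 1) * (2 * y - 1))) by ring.
by rewrite ler_wpM2l // ler_pM //; pos; lra.
Qed.

Lemma boros_moll_ratioE (R : realFieldType) m k : (k.+1 < m)%N ->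
  boros_moll_ratio R k.+1 m = boros_moll_slope R m k.+1 / boros_moll_slope R m k
     * ((k%:R + 1) / (k%:R + 2)).
Proof.
move=> km.
have d0 := lt0r_neq0 (boros_moll_gt0 R (ltnW (ltnW km))).
have d1 := lt0r_neq0 (boros_moll_gt0 R (ltnW km)).
have k1 : k%:R + 1 != 0 :> R by rewrite natr1 pnatr_eq0.
have k2 : k%:R + 2 != 0 :> R by rewrite -natrD pnatr_eq0 addn2.
rewrite /boros_moll_ratio /boros_moll_slope /= -natr1.
by field; rewrite ?d0 ?d1 ?k1 ?k2.
Qed.

(** Here [s1, ..., s4] are [s_(i-1), ..., s_(i+2)], [x = i] and [y = m - i].  The
    product of the two hypotheses compares [s1 s3^3] with [s2^3 s4], which is
    what is left of the conclusion once its denominators are cleared. *)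
Lemma ratio_ineq_of_slope_ineqs (R : realFieldType) (x y s1 s2 s3 s4 : R) :
  3 <= x -> 3 <= y -> 0 < s1 -> 0 < s2 -> 0 < s3 -> 0 < s4 ->
  (x + y + 1) * (s1 * s3) <= (x + y + 2) * s2 ^+ 2 ->
  (2 * x - 1) * (2 * y - 1) * s3 ^+ 2 <= 4 * x * y * (s2 * s4) ->
  (x - 2) * (y - 2) * (s3 / s2 * (x / (x + 1))) ^+ 2
    <= (x - 1) * (y - 1) * (s2 / s1 * ((x - 1) / x))
       * (s4 / s3 * ((x + 1) / (x + 2))).
Proof.
move=> x3 y3 p1 p2 p3 p4 A B.
have coef := @index_factor_ineq R x y _ _.
set c1 := (x - 2) * (y - 2) * x ^+ 3 * (x + 2) in coef.
set c2 := (x - 1) ^+ 2 * (y - 1) * (x + 1) ^+ 3 in coef.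
set e1 := (x + y + 2) * (4 * x * y) in coef.
set e2 := (x + y + 1) * ((2 * x - 1) * (2 * y - 1)) in coef.
have {}coef : c1 * e1 <= c2 * e2 by apply: coef; lra.
have c10 : 0 <= c1 by rewrite /c1; pos; lra.
have e20 : 0 < e2 by rewrite /e2; do 2?apply: mulr_gt0; lra.
have AB : e2 * (s1 * s3 * s3 ^+ 2) <= e1 * (s2 ^+ 2 * (s2 * s4)).
  have -> : e2 * (s1 * s3 * s3 ^+ 2)
    = (x + y + 1) * (s1 * s3) * ((2 * x - 1) * (2 * y - 1) * s3 ^+ 2).
    by rewrite /e2; ring.
  have -> : e1 * (s2 ^+ 2 * (s2 * s4))
    = (x + y + 2) * s2 ^+ 2 * (4 * x * y * (s2 * s4)).
    by rewrite /e1; ring.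
  by apply: ler_pM => //; pos; lra.
have main : c1 * (s1 * s3 * s3 ^+ 2) <= c2 * (s2 ^+ 2 * (s2 * s4)).
  rewrite -(ler_pM2l e20).
  apply: (@le_trans _ _ (c1 * e1 * (s2 ^+ 2 * (s2 * s4)))).
    by rewrite mulrCA -[X in _ <= X]mulrA; apply: ler_wpM2l.
  by rewrite [X in _ <= X]mulrA [e2 * c2]mulrC; apply: ler_wpM2r => //; pos; lra.
pose den := s1 * s2 ^+ 2 * s3 * x * (x + 1) ^+ 2 * (x + 2).
have den0 : 0 < den by rewrite /den; do ?[apply: mulr_gt0 | apply: exprn_gt0]; lra.
rewrite -(ler_pM2r den0).
have nz : [/\ s1 != 0, s2 != 0 & s3 != 0] by rewrite !lt0r_neq0.
have nx : [/\ x != 0, x + 1 != 0 & x + 2 != 0].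
  by split; apply: lt0r_neq0; lra.
case: nz nx => [n1 n2 n3] [m1 m2 m3].
have -> : (x - 2) * (y - 2) * (s3 / s2 * (x / (x + 1))) ^+ 2 * den
   = c1 * (s1 * s3 * s3 ^+ 2).
  by rewrite /den /c1; field; rewrite n2 m2.
have -> : (x - 1) * (y - 1) * (s2 / s1 * ((x - 1) / x))
       * (s4 / s3 * ((x + 1) / (x + 2))) * den = c2 * (s2 ^+ 2 * (s2 * s4)).
  by rewrite /den /c2; field; rewrite n1 n3 m1 m3.
by [].
Qed.

Theorem theorem1p3 (R : realFieldType) (m : nat) (hm : (2 <= m)%N) :
  reverse_ultra_log_concave (m - 4)
    (fun k : nat => boros_moll_ratio R (k + 2) m)
  /\
  (forall i : nat, (3 <= i <= m - 3)%N ->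
    (i%:R - 2) * (m%:R - i%:R - 2) * boros_moll_ratio R i m ^+ 2
      <= (i%:R - 1) * (m%:R - i%:R - 1)
         * boros_moll_ratio R i.-1 m * boros_moll_ratio R i.+1 m).
Proof.
suff main i : (3 <= i <= m - 3)%N ->
    (i%:R - 2) * (m%:R - i%:R - 2) * boros_moll_ratio R i m ^+ 2
      <= (i%:R - 1) * (m%:R - i%:R - 1)
         * boros_moll_ratio R i.-1 m * boros_moll_ratio R i.+1 m.
  split=> // -[//|k] /andP[_ km].
  have := main k.+3; rewrite !addn2 /= => /(_ _).
  have m4 : (4 <= m)%N by lia.
  rewrite natrB // -(natr1 k.+2) -(natr1 k.+1) => H.
  have {}H := H ltac:(lia).
  rewrite -subr_le0 in H *.
  apply: le_trans H; rewrite le_eqVlt; apply/orP; left; apply/eqP; ring.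
case: i => [|[|[|j]]] // /andP[_ jm].
rewrite [j.+3.-1]/= !boros_moll_ratioE; try by lia.
have [l1 l2 l3 l4] : [/\ j.+1 < m, j.+2 < m, j.+3 < m & j.+4 < m]%N by split; lia.
have E1 := boros_moll_slope_rec R l1.
have E2 := boros_moll_slope_rec R l2.
have E3 := boros_moll_slope_rec R l3.
have U2 := boros_moll_slope_ub R (ltnW l2).
have U3 := boros_moll_slope_ub R (ltnW l3).
have L3 := boros_moll_slope_lb R (ltnW l3).
have P1 := boros_moll_slope_gt0 R l1.
have P2 := boros_moll_slope_gt0 R l2.
have P3 := boros_moll_slope_gt0 R l3.
have P4 := boros_moll_slope_gt0 R l4.
move: (boros_moll_slope R m j.+1) (boros_moll_slope R m j.+2)
  (boros_moll_slope R m j.+3) (boros_moll_slope R m j.+4)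
  E1 E2 E3 U2 U3 L3 P1 P2 P3 P4
  => s1 s2 s3 s4 E1 E2 E3 U2 U3 L3 P1 P2 P3 P4.
have x3 : 3 <= j.+3%:R :> R by rewrite ler_nat.
have y3 : 3 <= m%:R - j.+3%:R :> R by rewrite -natrB ?ler_nat; lia.
have e2 : j.+2%:R = j.+3%:R - 1 :> R by rewrite -[in RHS]natr1 addrK.
have e1 : j.+1%:R = j.+3%:R - 2 :> R.
  by rewrite -[in RHS]natr1 -[in RHS]natr1; ring.
rewrite e1 e2 in E1 E2 E3 U2 U3 L3 *.
move: (j.+3%:R : R) (m%:R : R) x3 y3 E1 E2 E3 U2 U3 L3
  => x M x3 y3 E1 E2 E3 U2 U3 L3.
(* The upper bound is used at [k = i], where [h = m - i + 1], and the lower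
   bound at [k = i + 1], where [h = m - i]. *)
have A : (x + (M - x) + 1) * (s1 * s3) <= (x + (M - x) + 2) * s2 ^+ 2.
  have -> : x + (M - x) + 1 = M - x + 1 + x by ring.
  have -> : x + (M - x) + 2 = M - x + 1 + x + 1 by ring.
  by apply: slope_quotient_upper; lra.
have B : (2 * x - 1) * (2 * (M - x) - 1) * s3 ^+ 2 <= 4 * x * (M - x) * (s2 * s4).
  have -> : 2 * x - 1 = 2 * (x + 1) - 3 by ring.
  have -> : 4 * x = 4 * (x + 1 - 1) by ring.
  apply: slope_quotient_lower; try lra.
  have ub : (2 * M + 3) * s3 <= (2 * M + 3) * (M - x) by lra.
  by rewrite ler_pM2l in ub; lra.
have := @ratio_ineq_of_slope_ineqs R x (M - x) s1 s2 s3 s4 x3 y3 P1 P2 P3 P4 A B.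
have -> : x - 2 + 1 = x - 1 by ring.
have -> : x - 2 + 2 = x by ring.
have -> : x - 1 + 1 = x by ring.
have -> : x - 1 + 2 = x + 1 by ring.
by [].
Qed.
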